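(* Consider the problem $$\min_{x_1,\dots,x_n}\ \sum_{i=1}^n f_i(x_i)\quad\text{s.t.}\quad \sum_{i=1}^n \mathcal{A}_i(x_i)=b ,\qquad f_i=g_i+h_i .$$ If $\{\beta_k\}$ is non-decreasing and upper bounded and $\tau_i^{(k)}=T_i+\beta_k\eta_i$, where $T_i\ge L_i$ and $\eta_i>n\|\mathcal{A}_i\|^2$ are positive constants, $i=1,\dots,n$, then the sequence $\{(x_1^k,\dots,x_n^k,\lambda^k)\}$ generated by proximal LADMPSAP (from any initial point) converges to a KKT point of the problem.
   Context: Data: $g_i,h_i$ are convex on $\mathbb{R}^{d_i}$; $g_i$ is finite and differentiable with $\|\nabla g_i(x)-\nabla g_i(y)\|\le L_i\|x-y\|$ for all $x,y\in\mathbb{R}^{d_i}$; $h_i$ may be non-differentiable; $f_i=g_i+h_i$ is closed proper convex. $\mathcal{A}_i:\mathbb{R}^{d_i}\to\mathbb{R}^m$ are linear mappings with adjoints $\mathcal{A}_i^\dagger$ and operator norms $\|\mathcal{A}_i\|$; $b\in\mathbb{R}^m$; $\|\cdot\|$ is the Euclidean (Frobenius) norm. Standing assumptions: no $\mathcal{A}_i$ is the zero mapping; the solution of $\sum_i\mathcal{A}_i(x_i)=b$ is non-unique; $(x_1,\dots,x_n)\mapsto\sum_i\mathcal{A}_i(x_i)$ is onto; the problem has a KKT point. KKT point: $(x_1^*,\dots,x_n^*,\lambda^* )$ with $\sum_i\mathcal{A}_i(x_i^* )=b$ and $-\mathcal{A}_i^\dagger(\lambda^* )\in\partial f_i(x_i^*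 )$ for all $i$. Proximal LADMPSAP, with penalty parameters $\beta_k>0$, run without stopping: given $(x_1^k,\dots,x_n^k,\lambda^k)$, set $$\hat\lambda^k=\lambda^k+\beta_k\Big(\sum_{i=1}^n\mathcal{A}_i(x_i^k)-b\Big),$$ $$x_i^{k+1}=\operatorname*{argmin}_{x_i}\ h_i(x_i)+\frac{\tau_i^{(k)}}{2}\Big\|x_i-x_i^k+\frac{1}{\tau_i^{(k)}}\big[\mathcal{A}_i^\dagger(\hat\lambda^k)+\nabla g_i(x_i^k)\big]\Big\|^2,\quad i=1,\dots,n,$$ $$\lambda^{k+1}=\lambda^k+\beta_k\Big(\sum_{i=1}^n\mathcal{A}_i(x_i^{k+1})-b\Big).$$ *)

(* Defs.v *)
From HB Require Import structures.
From mathcomp Require Import all_boot all_order all_algebra.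
From mathcomp Require Import all_classical all_reals all_analysis.
Import Order.TTheory GRing.Theory Num.Theory.
Import numFieldNormedType.Exports.

Set Implicit Arguments.
Unset Strict Implicit.
Unset Printing Implicit Defensive.

Local Open Scope classical_set_scope.
Local Open Scope ring_scope.

(* Vectors of R^d are row vectors, to match lin1_mx, which represents linear
   maps by right multiplication.                                             *)

Definition dot (R : realType) (d : nat) (u v : 'rV[R]_d) : R :=
  \sum_j u 0 j * v 0 j.

(* The library norm `|x| on 'rV[R]_d is the sup norm, so the Euclidean norm
   has to be a separate definition; the two induce the same topology.        *)
Definition enorm (R : realType) (d : nat) (u : 'rV[R]_d) : R :=
  Num.sqrt (dot u u).

Definition opnorm (R : realType) (d m : nat)
    (A : {linear 'rV[R]_d -> 'rV[R]_m}) : R :=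
  sup [set enorm (A x) | x in [set x : 'rV[R]_d | enorm x <= 1]].

(* With row vectors A x = x *m lin1_mx A, so the adjoint acts by the
   transposed matrix; dot_adjoint is its defining property.                  *)
Definition adjoint (R : realType) (d m : nat)
    (A : {linear 'rV[R]_d -> 'rV[R]_m}) (u : 'rV[R]_m) : 'rV[R]_d :=
  u *m (lin1_mx A)^T.

Lemma dot_adjoint (R : realType) (d m : nat)
    (A : {linear 'rV[R]_d -> 'rV[R]_m}) (x : 'rV[R]_d) (u : 'rV[R]_m) :
  dot (A x) u = dot x (adjoint A u).
Proof.
have dotE k (v w : 'rV[R]_k) : dot v w = (v *m w^T) 0 0.
  by rewrite mxE; apply: eq_bigr => j _; rewrite mxE.
by rewrite !dotE /adjoint trmx_mul trmxK mulmxA mul_rV_lin1.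
Qed.

Definition grad (R : realType) (d : nat) (g : 'rV[R]_d -> R) (x : 'rV[R]_d) :
    'rV[R]_d :=
  \row_j 'D_(delta_mx 0 j) g x.

Definition epigraph (R : realType) (d : nat) (f : 'rV[R]_d -> \bar R) :
    set ('rV[R]_d * R^o) :=
  [set p | (f p.1 <= p.2%:E)%E].

(* Convexity of extended-real-valued functions goes through the epigraph,
   which avoids sums of the form +oo - oo.                                   *)
Definition econvex (R : realType) (d : nat) (f : 'rV[R]_d -> \bar R) : Prop :=
  @convex_set R ('rV[R]_d * R^o)%type (epigraph f).

Definition proper (R : realType) (d : nat) (f : 'rV[R]_d -> \bar R) : Prop :=
  (forall x, (-oo < f x)%E) /\ (exists x, (f x < +oo)%E).

Definition closed_proper_convex (R : realType) (d : nat)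
    (f : 'rV[R]_d -> \bar R) : Prop :=
  [/\ closed (epigraph f), proper f & econvex f].

Definition subdifferential (R : realType) (d : nat) (f : 'rV[R]_d -> \bar R)
    (x : 'rV[R]_d) : set 'rV[R]_d :=
  [set s | forall y, (f x + (dot s (y - x))%:E <= f y)%E].

Definition argmin (T : Type) (R : realType) (F : T -> \bar R) : set T :=
  [set x | forall y, (F x <= F y)%E].

Definition blocks (R : realType) (n : nat) (d : 'I_n -> nat) : Type :=
  forall i : 'I_n, 'rV[R]_(d i).

Definition composite (R : realType) (n : nat) (d : 'I_n -> nat)
    (g : forall i, 'rV[R]_(d i) -> R) (h : forall i, 'rV[R]_(d i) -> \bar R) :
    forall i, 'rV[R]_(d i) -> \bar R :=
  fun i x => ((g i x)%:E + h i x)%E.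
Arguments composite {R n d} g h i x.

Definition constraint_map (R : realType) (n m : nat) (d : 'I_n -> nat)
    (A : forall i, {linear 'rV[R]_(d i) -> 'rV[R]_m}) (x : blocks R d) :
    'rV[R]_m :=
  \sum_i A i (x i).

Definition KKT_point (R : realType) (n m : nat) (d : 'I_n -> nat)
    (f : forall i, 'rV[R]_(d i) -> \bar R)
    (A : forall i, {linear 'rV[R]_(d i) -> 'rV[R]_m}) (b : 'rV[R]_m)
    (x : blocks R d) (lam : 'rV[R]_m) : Prop :=
  constraint_map A x = b /\
  forall i, subdifferential (f i) (x i) (- adjoint (A i) lam).

Definition lambda_hat (R : realType) (n m : nat) (d : 'I_n -> nat)
    (A : forall i, {linear 'rV[R]_(d i) -> 'rV[R]_m}) (b : 'rV[R]_m)
    (beta : R) (x : blocks R d) (lam : 'rV[R]_m) : 'rV[R]_m :=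
  lam + beta *: (constraint_map A x - b).

Definition prox_objective (R : realType) (d : nat) (h : 'rV[R]_d -> \bar R)
    (tau : R) (xk v : 'rV[R]_d) : 'rV[R]_d -> \bar R :=
  fun x => (h x + (tau / 2 * enorm (x - xk + tau^-1 *: v) ^+ 2)%:E)%E.

(* The proximal subproblems are strongly convex, so membership in the argmin
   set determines x k.+1. The initial point (x 0, lam 0) is unconstrained.   *)
Definition proximal_LADMPSAP (R : realType) (n m : nat) (d : 'I_n -> nat)
    (g : forall i, 'rV[R]_(d i) -> R) (h : forall i, 'rV[R]_(d i) -> \bar R)
    (A : forall i, {linear 'rV[R]_(d i) -> 'rV[R]_m}) (b : 'rV[R]_m)
    (beta : nat -> R) (tau : nat -> 'I_n -> R)
    (x : nat -> blocks R d) (lam : nat -> 'rV[R]_m) : Prop :=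
  forall k,
    (forall i,
       argmin (prox_objective (h i) (tau k i) (x k i)
                 (adjoint (A i) (lambda_hat A b (beta k) (x k) (lam k))
                  + grad (g i) (x k i)))
              (x k.+1 i)) /\
    lam k.+1 = lam k + beta k *: (constraint_map A (x k.+1) - b).

(* Main.v *)
Require Import Defs.
From mathcomp Require Import all_boot all_order all_algebra.
From mathcomp Require Import all_classical all_reals all_analysis.
From mathcomp Require Import ring lra.
Import Order.TTheory GRing.Theory Num.Theory.
Import numFieldNormedType.Exports.

(** Write [D_i = x_i^(k+1) - x_i^k] and [r = sum_i A_i x_i^k - b]. The optimality
    condition of the proximal subproblem, the tangent inequality for the convex
    [g_i] and the descent lemma for its Lipschitz gradient together say that
    [- (tau_i D_i + A_i^T lambda_hat)] is an epsilon-subgradient of the whole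
    summand [f_i = g_i + h_i] at the new iterate, with
    [epsilon = L_i / 2 * |D_i|^2] ([prox_gradient_step]). From there on the
    splitting of [f_i] is forgotten.

    Monotonicity of (epsilon-)subdifferentials, applied block by block against
    a KKT point [(xs, ls)] and summed, gives a Fejer-type inequality
    ([lyapunov_descent]) for
      [V_k = |lam - ls|^2 / beta^2 + sum_i (T_i / beta + eta_i) |x_i - xs_i|^2]:
      [V_(k+1) + |r|^2 + sum_i (eta_i - n |A_i|^2) |D_i|^2 <= V_k].
    Both weights in [V] decrease in [beta], which is why a growing penalty does
    no harm. Summing up, [r] and all [D_i] vanish, and since [beta] is bounded
    the iterates are bounded.

    A bounded sequence converges along any ultrafilter, so taking one that
    refines the filter at infinity produces a limit [(xs, ls)] of the whole
    family of blocks and of the multiplier at once. Closedness of the graph of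
    the subdifferential ([eps_subdifferential_limit]) makes it a KKT point. Its
    own [V_k] is nonincreasing and tends to [0] along the ultrafilter, hence
    tends to [0] ([nonincreasing_cvg0]), and [V_k] controls the distance to
    [(xs, ls)]. *)

Set Implicit Arguments.
Unset Strict Implicit.

Local Open Scope classical_set_scope.
Local Open Scope ring_scope.

(** * Euclidean geometry of row vectors *)

Lemma dotC (R : realType) d (u v : 'rV[R]_d) : dot u v = dot v u.
Proof. by apply: eq_bigr => j _; rewrite mulrC. Qed.

Lemma dotDl (R : realType) d (u v w : 'rV[R]_d) :
  dot (u + v) w = dot u w + dot v w.
Proof. by rewrite -big_split; apply: eq_bigr => j _; rewrite mxE mulrDl. Qed.

Lemma dotZl (R : realType) d (a : R) (u w : 'rV[R]_d) :
  dot (a *: u) w = a * dot u w.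
Proof. by rewrite [RHS]mulr_sumr; apply: eq_bigr => j _; rewrite mxE mulrA. Qed.

Lemma dotNl (R : realType) d (u w : 'rV[R]_d) : dot (- u) w = - dot u w.
Proof. by rewrite -scaleN1r dotZl mulN1r. Qed.

Lemma dot0l (R : realType) d (w : 'rV[R]_d) : dot 0 w = 0.
Proof. by rewrite -(scale0r 0) dotZl mul0r. Qed.

Lemma dotDr (R : realType) d (u v w : 'rV[R]_d) :
  dot w (u + v) = dot w u + dot w v.
Proof. by rewrite dotC dotDl !(dotC w). Qed.

Lemma dotZr (R : realType) d (a : R) (u w : 'rV[R]_d) :
  dot w (a *: u) = a * dot w u.
Proof. by rewrite dotC dotZl (dotC w). Qed.

Lemma dotNr (R : realType) d (u w : 'rV[R]_d) : dot w (- u) = - dot w u.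
Proof. by rewrite dotC dotNl (dotC w). Qed.

Lemma dot_sumr (R : realType) d (I : finType) (u : I -> 'rV[R]_d) w :
  dot w (\sum_i u i) = \sum_i dot w (u i).
Proof.
elim/big_ind2: _ => [|? ? ? ? <- <-|//]; first by rewrite dotC dot0l.
exact: dotDr.
Qed.

Definition dotE := (dotDl, dotDr, dotNl, dotNr, dotZl, dotZr).

Lemma dot_ge0 (R : realType) d (u : 'rV[R]_d) : 0 <= dot u u.
Proof. by apply: sumr_ge0 => j _; rewrite -expr2 sqr_ge0. Qed.

Lemma enorm_ge0 (R : realType) d (u : 'rV[R]_d) : 0 <= enorm u.
Proof. exact: sqrtr_ge0. Qed.

Lemma sqr_enorm (R : realType) d (u : 'rV[R]_d) : enorm u ^+ 2 = dot u u.
Proof. by rewrite sqr_sqrtr// dot_ge0. Qed.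

Lemma coord_sqr_le (R : realType) d (u : 'rV[R]_d) j :
  u 0 j ^+ 2 <= enorm u ^+ 2.
Proof.
rewrite sqr_enorm /dot (bigD1 j)//= expr2 lerDl.
by apply: sumr_ge0 => k _; rewrite -expr2 sqr_ge0.
Qed.

Lemma norm_coord_le (R : realType) d (u : 'rV[R]_d) j :
  `|u 0 j| <= enorm u.
Proof.
rewrite -(@ler_pXn2r _ 2)// ?nnegrE ?enorm_ge0//.
by rewrite real_normK ?num_real// coord_sqr_le.
Qed.

(** The topology of row vectors is that of the sup norm; this comparison
    carries Euclidean estimates over to it. *)
Lemma norm_le_enorm (R : realType) d (u : 'rV[R]_d) : `|u| <= enorm u.
Proof.
rewrite /Num.Def.normr/= mx_normrE; apply/bigmax_leP.
by split=> [|[i j] _ /=]; rewrite ?enorm_ge0// ord1 norm_coord_le.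
Qed.

(** Cauchy-Schwarz, from [0 <= | |v| u - |u| v |^2] divided by [2 |u| |v|]. *)
Lemma dot_le_enorm (R : realType) d (u v : 'rV[R]_d) :
  dot u v <= enorm u * enorm v.
Proof.
have := dot_ge0 (enorm v *: u - enorm u *: v).
rewrite !dotE -!sqr_enorm (dotC v u).
have [|up] := leP (enorm u) 0; last have [|vp] := leP (enorm v) 0.
- rewrite le_eqVlt ltNge enorm_ge0 orbF => /eqP u0 _.
  suff -> : dot u v = 0 by rewrite mulr_ge0 ?enorm_ge0.
  apply: big1 => j _; suff -> : u 0 j = 0 by rewrite mul0r.
  by apply/eqP; rewrite -normr_le0 -u0 norm_coord_le.
- rewrite le_eqVlt ltNge enorm_ge0 orbF => /eqP u0 _.
  suff -> : dot u v = 0 by rewrite mulr_ge0 ?enorm_ge0.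
  apply: big1 => j _; suff -> : v 0 j = 0 by rewrite mulr0.
  by apply/eqP; rewrite -normr_le0 -u0 norm_coord_le.
move=> h; rewrite -subr_ge0 -(@pmulr_rge0 _ (2 * (enorm u * enorm v)))//.
  by apply: le_trans h _; rewrite le_eqVlt; apply/orP; left; apply/eqP; ring.
by rewrite !mulr_gt0.
Qed.

Lemma enormZ (R : realType) d (a : R) (u : 'rV[R]_d) :
  enorm (a *: u) = `|a| * enorm u.
Proof. by rewrite /enorm !dotE mulrA -expr2 sqrtrM ?sqr_ge0// sqrtr_sqr. Qed.

(** Expand the square and bound each of the [n^2] products by
    [2 <u, v> <= |u|^2 + |v|^2]. This is where the factor [n] in the condition
    on the proximal parameters comes from. *)
Lemma sqr_enorm_sum_le (R : realType) d n (u : 'I_n -> 'rV[R]_d) :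
  enorm (\sum_i u i) ^+ 2 <= n%:R * \sum_i enorm (u i) ^+ 2.
Proof.
have ub i j : dot (u i) (u j) <= (enorm (u i) ^+ 2 + enorm (u j) ^+ 2) / 2.
  have := dot_ge0 (u i - u j); rewrite !dotE -!sqr_enorm (dotC (u j)); lra.
rewrite sqr_enorm dot_sumr.
under eq_bigr do rewrite dotC dot_sumr.
apply: le_trans (ler_sum _ (fun i _ => ler_sum _ (fun j _ => ub i j))) _.
under eq_bigr do rewrite -mulr_suml big_split/= sumr_const card_ord.
rewrite -mulr_suml big_split/= sumr_const card_ord -sumrMnl.
rewrite -mulr_natl mulr_sumr; under eq_bigr do rewrite -mulr_natl.
by rewrite -mulr_sumr; lra.
Qed.

(** The supremum defining [opnorm] only bounds its elements once the set is
    known to be bounded above; the images of the standard basis provide a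
    bound. *)
Lemma opnorm_le (R : realType) d m (A : {linear 'rV[R]_d -> 'rV[R]_m}) x :
  enorm (A x) <= opnorm A * enorm x.
Proof.
set E := [set enorm (A y) | y in [set y : 'rV[R]_d | enorm y <= 1]].
have ubE : has_ubound E.
  exists (Num.sqrt (d%:R * \sum_j enorm (A (delta_mx 0 j)) ^+ 2)) => _ [y y1 <-].
  rewrite -[enorm _](ger0_norm (enorm_ge0 _)) -sqrtr_sqr ler_wsqrtr//.
  rewrite [y]row_sum_delta linear_sum; apply: (le_trans (sqr_enorm_sum_le _)).
  apply: ler_wpM2l => //; apply: ler_sum => j _.
  rewrite linearZ enormZ exprMn ler_piMl ?sqr_ge0// exprn_ile1//.
  exact: le_trans (norm_coord_le _ _) y1.
have [x0|x0] := eqVneq (enorm x) 0.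
  have -> : x = 0.
    apply/rowP => j; apply/eqP; rewrite mxE -normr_le0 -x0; exact: norm_coord_le.
  by rewrite linear0 /enorm !dot0l sqrtr0 mulr0.
have xp : 0 < enorm x by rewrite lt_def x0 enorm_ge0.
rewrite -ler_pdivrMr// mulrC.
apply: ub_le_sup => //; exists ((enorm x)^-1 *: x).
  by rewrite /= enormZ ger0_norm ?invr_ge0 ?enorm_ge0// mulVf.
by rewrite linearZ enormZ ger0_norm// invr_ge0 enorm_ge0.
Qed.

(** * Tangent inequality and descent lemma *)

Lemma derive_dot_grad (R : realType) d (g : 'rV[R]_d -> R) x v :
  differentiable g x -> 'D_v g x = dot (grad g x) v.
Proof.
move=> dg; rewrite deriveE// {1}[v]row_sum_delta linear_sum.
by apply: eq_bigr => j _; rewrite linearZ/= mxE deriveE// mulrC.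
Qed.

Lemma is_derive_line (R : realType) d (g : 'rV[R]_d -> R) x v (t : R) :
  differentiable g (x + t *: v) ->
  is_derive t 1 (fun s => g (x + s *: v)) (dot (grad g (x + t *: v)) v).
Proof.
move=> dg; have {}dg' := diff_derivable (v:=v) dg.
have E : (fun h : R => h^-1 *: (((fun s => g (x + s *: v)) \o shift t) (h *: 1)
       - g (x + t *: v)))
   = (fun h : R => h^-1 *: ((g \o shift (x + t *: v)) (h *: v) - g (x + t *: v))).
  apply/funext => h /=; congr (_ *: (g _ - _)).
  by rewrite /= addrCA -scalerDl [h%:A]mulr1.
split; first by rewrite /derivable E.
by rewrite /derive E -derive_dot_grad.
Qed.

(** Convexity bounds the difference quotients at [x] in direction [y - x], for
    steps in ]0, 1], by [g y - g x]; their limit at [0^+] is the derivative. *)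
Lemma convex_ge_tangent (R : realType) d (g : 'rV[R]_d -> R) x y :
  @convex_function R 'rV[R]_d setT g -> differentiable g x ->
  g x + dot (grad g x) (y - x) <= g y.
Proof.
move=> cg dg; rewrite -lerBrDl -derive_dot_grad//.
have dv := diff_derivable (v:=y - x) dg.
apply: (cvgr_to_le (cvg_dnbhs_at_right dv)).
near=> t.
have t0 : 0 < t by near: t; exact: nbhs_right_gt.
have t1 : t <= 1 by near: t; exact: nbhs_right_le.
have := cg (Itv01 (ltW t0) t1) y x; rewrite !inE => /(_ I I).
rewrite convRE /= /conv/= => h.
rewrite [_ *: _]mulrC ler_pdivrMr// lerBlDr.
apply: le_trans (_ : g (t *: y + (1 - t) *: x) <= _).
  rewrite le_eqVlt; apply/orP; left; apply/eqP; congr g.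
  by rewrite scalerBr scalerBl scale1r addrAC addrA.
apply: le_trans h _; rewrite /unstable.onem; lra.
Unshelve. all: by end_near. Qed.

(** Along the segment from [x] to [y], the gap between [g] and its quadratic
    upper model at [x] has a nonpositive derivative, by Cauchy-Schwarz and the
    Lipschitz bound. *)
Lemma descent_lemma (R : realType) d (g : 'rV[R]_d -> R) (L : R) x y :
  (forall z, differentiable g z) ->
  (forall z w, enorm (grad g z - grad g w) <= L * enorm (z - w)) ->
  g y <= g x + dot (grad g x) (y - x) + L / 2 * enorm (y - x) ^+ 2.
Proof.
move=> dg Lg; set v := y - x.
pose a := dot (grad g x) v; pose c := L / 2 * enorm v ^+ 2.
pose psi t := g (x + t *: v) - (a * t + c * t ^+ 2).
have dpsi (t : R) : is_derive t 1 psi (dot (grad g (x + t *: v)) v - (a + c * (2 * t))).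
  rewrite /psi.
  have H1 := is_derive_line (dg (x + t *: v)).
  have H2 : is_derive t 1 (fun t : R => a * t + c * t ^+ 2) (a + c * (2 * t)).
    apply: is_derive_eq; rewrite /GRing.scale/=; ring.
  exact: is_deriveB.
have : psi 1 <= psi 0.
  apply: (@ler0_derive1_le_cc _ psi 0 1) => //.
  - move=> t; rewrite in_itv/= => /andP[t0 t1].
    have [_] := dpsi t; rewrite derive1E=> ->; rewrite /a -subr_ge0.
    have := le_trans (dot_le_enorm (grad g (x + t *: v) - grad g x) v)
      (ler_wpM2r (enorm_ge0 v) (Lg _ _)).
    rewrite dotDl dotNl addrAC subrr add0r enormZ gtr0_norm// /c.
    lra.
  - apply: continuous_subspaceT => t; apply: differentiable_continuous.
    by apply/derivable1_diffP; have [] := dpsi t.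
  - by rewrite in_itv/= lexx ler01.
  - by rewrite in_itv/= lexx ler01.
rewrite /psi !scale1r scale0r addr0 [x + v]addrC subrK -/a -/c expr1n expr0n/=.
lra.
Qed.

(** * Epsilon-subgradients and the proximal gradient step *)

Definition eps_subdifferential (R : realType) (d : nat) (f : 'rV[R]_d -> \bar R)
    (eps : R) (x : 'rV[R]_d) : set 'rV[R]_d :=
  [set s | forall y, (f x + (dot s (y - x) - eps)%:E <= f y)%E].

Lemma eps_subdifferential_fin_num (R : realType) d (f : 'rV[R]_d -> \bar R)
    eps x s :
  Defs.proper f -> eps_subdifferential f eps x s -> f x \is a fin_num.
Proof.
move=> [fNy [z fz]] /(_ z); rewrite fin_numElt fNy /=.
by case: (f x) => [r|//|]; rewrite ?ltry//; move: fz; case: (f z).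
Qed.

Lemma subdifferential_eps0 (R : realType) d (f : 'rV[R]_d -> \bar R) x :
  subdifferential f x = eps_subdifferential f 0 x.
Proof.
by apply/seteqP; split=> s fs y; have := fs y; rewrite subr0.
Qed.

(** Add the two subgradient inequalities, each tested at the other point; the
    values of [f] cancel because they are finite. *)
Lemma eps_subdifferential_monotone (R : realType) d (f : 'rV[R]_d -> \bar R)
    eps x s eps' x' s' :
  Defs.proper f -> eps_subdifferential f eps x s -> eps_subdifferential f eps' x' s' ->
  - (eps + eps') <= dot (s - s') (x - x').
Proof.
move=> pf fs fs'.
have := fs x'; have := fs' x.
rewrite -(fineK (eps_subdifferential_fin_num pf fs)).
rewrite -(fineK (eps_subdifferential_fin_num pf fs')).
rewrite !lee_fin !dotE; lra.
Qed.

Lemma econvex_le (R : realType) d (h : 'rV[R]_d -> \bar R) x y (r s t : R) :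
  econvex h -> 0 <= t -> t <= 1 -> (h x <= r%:E)%E -> (h y <= s%:E)%E ->
  (h (t *: x + (1 - t) *: y)%R <= (t * r + (1 - t) * s)%:E)%E.
Proof.
move=> ch t0 t1 hx hy.
have := ch (x, r) (y, s) (Itv01 t0 t1); rewrite !inE.
by move=> /(_ hx hy).
Qed.

Lemma proper_summand (R : realType) d (g : 'rV[R]_d -> R) (h : 'rV[R]_d -> \bar R) :
  Defs.proper (fun x => (g x)%:E + h x)%E -> Defs.proper h.
Proof.
move=> [fNy [z fz]]; split=> [x|].
  by have := fNy x; case: (h x) => // ? _; rewrite ltNyr.
by exists z; move: fz; case: (h z) => // ? _; rewrite ltry.
Qed.

(** The limit [t -> 0] that turns a minimality condition on a segment into a
    first-order one. *)
Lemma ge0_of_affine (R : realFieldType) (a c : R) :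
  (forall t, 0 < t -> t <= 1 -> 0 <= a + t * c) -> 0 <= a.
Proof.
move=> H; rewrite leNgt; apply/negP => a0.
have [c0|c0] := leP c 0; first by have := H 1 ltr01 (lexx 1); lra.
have d0 : 0 < c - a by lra.
(* a step in ]0, 1] small enough for the affine function to stay negative *)
have := H (- a / (2 * (c - a))).
rewrite divr_gt0 ?mulr_gt0 ?oppr_gt0// => /(_ isT).
rewrite ler_pdivrMr ?mulr_gt0// mul1r => H1.
have {H1} : 0 <= a + - a / (2 * (c - a)) * c by apply: H1; lra.
have -> : a + - a / (2 * (c - a)) * c = a * (c - 2 * a) / (2 * (c - a)).
  by field; rewrite gt_eqF.
rewrite leNgt => /negP; apply.
by rewrite pmulr_llt0 ?invr_gt0 ?mulr_gt0// nmulr_rlt0//; lra.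
Qed.

(** Fermat's rule for [h + tau / 2 * |. - xk + v / tau|^2] without a sum rule:
    compare the minimizer [x] with [x + t (z - x)], bound [h] there by
    convexity, divide by [t] and let [t] tend to [0]. *)
Lemma prox_subgradient (R : realType) d (h : 'rV[R]_d -> \bar R) tau xk v x :
  econvex h -> Defs.proper h -> 0 < tau -> argmin (prox_objective h tau xk v) x ->
  subdifferential h x (- (tau *: (x - xk) + v)).
Proof.
move=> ch [hNy [z0 hz0]] tau0 xmin z.
have hx : h x \is a fin_num.
  have := xmin z0; rewrite /prox_objective fin_numElt hNy /=.
  by case: (h x) => [r|//|]; rewrite ?ltry//; move: hz0; case: (h z0).
have := hNy z; case E : (h z) => [s| |]//; last by rewrite leey.
move=> _; rewrite -(fineK hx) -EFinD lee_fin -subr_ge0.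
set r := fine (h x).
set w := x - xk + tau^-1 *: v.
have -> : tau *: (x - xk) + v = tau *: w.
  by rewrite /w [RHS]scalerDr scalerA mulfV ?gt_eqF// scale1r.
set q := z - x.
apply: (@ge0_of_affine _ _ (tau / 2 * dot q q)) => t t0 t1.
have hq : (h (x + t *: q)%R <= (t * s + (1 - t) * r)%:E)%E.
  have -> : x + t *: q = t *: z + (1 - t) *: x.
    by rewrite /q scalerBr scalerBl scale1r addrCA.
  by apply: econvex_le; rewrite ?(ltW t0)// ?E// -(fineK hx).
have := xmin (x + t *: q); rewrite /prox_objective -/w.
have -> : x + t *: q - xk + tau^-1 *: v = w + t *: q.
  by rewrite /w -!addrA; congr (_ + _); rewrite addrC -!addrA.
move=> /le_trans /(_ (leeD2r _ hq)).
(* otherwise the bilinearity rules see through [w] and [q] and expand them *)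
clearbody w q; rewrite -(fineK hx) -/r -!EFinD lee_fin !sqr_enorm !dotE (dotC q w) => H.
rewrite -(@pmulr_rge0 _ t)//; lra.
Qed.

(** The subgradient of [h] at [x] contains the gradient of [g] at the old point
    [xk]; trading it for a subgradient of [g] at [x] costs the error of the
    quadratic upper model, hence the value of epsilon. *)
Lemma prox_gradient_step (R : realType) d (g : 'rV[R]_d -> R)
    (h : 'rV[R]_d -> \bar R) L tau xk w x :
  @convex_function R 'rV[R]_d setT g -> (forall z, differentiable g z) ->
  (forall z z', enorm (grad g z - grad g z') <= L * enorm (z - z')) ->
  econvex h -> Defs.proper h -> 0 < tau ->
  argmin (prox_objective h tau xk (w + grad g xk)) x ->
  eps_subdifferential (fun z => (g z)%:E + h z)%E
    (L / 2 * enorm (x - xk) ^+ 2) x (- (tau *: (x - xk) + w)).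
Proof.
move=> cg dg Lg ch ph tau0 xmin z.
have /(_ z) hs := prox_subgradient ch ph tau0 xmin.
have hx : h x \is a fin_num.
  have := prox_subgradient ch ph tau0 xmin; rewrite subdifferential_eps0.
  exact: eps_subdifferential_fin_num.
have gx := descent_lemma xk x dg Lg.
have gz := convex_ge_tangent z cg (dg xk).
move: hs; have [hNy _] := ph; have := hNy z.
case: (h z) => [s _| _ _|]//; last by rewrite addey// leey.
rewrite -(fineK hx) -!EFinD !lee_fin.
have -> : z - x = (z - xk) - (x - xk) by rewrite opprB addrA subrK.
move: gx gz; rewrite !sqr_enorm !dotE; lra.
Qed.

(** * The Lyapunov function *)

(** The squared distance to [(xs, ls)], in a metric divided by [beta ^+ 2] so that
    every weight is nonincreasing in [beta]; the block weight is the proximal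
    parameter [T i + beta * eta i] divided by [beta]. *)
Definition lyapunov (R : realType) (n m : nat) (d : 'I_n -> nat) (beta : R)
    (T eta : 'I_n -> R) (xs : blocks R d) (ls : 'rV[R]_m)
    (x : blocks R d) (lam : 'rV[R]_m) : R :=
  enorm (lam - ls) ^+ 2 / beta ^+ 2 +
  \sum_i (T i / beta + eta i) * enorm (x i - xs i) ^+ 2.

Lemma lyapunov_antitone (R : realType) (n m : nat) (d : 'I_n -> nat)
    (beta beta' : R) (T eta : 'I_n -> R) (xs : blocks R d) (ls : 'rV[R]_m)
    (x : blocks R d) (lam : 'rV[R]_m) :
  (forall i, 0 <= T i) -> 0 < beta -> beta <= beta' ->
  lyapunov beta' T eta xs ls x lam <= lyapunov beta T eta xs ls x lam.
Proof.
move=> T0 b0 bb; have b0' : 0 < beta' by exact: lt_le_trans bb.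
apply: lerD.
  rewrite ler_wpM2l ?sqr_ge0// lef_pV2 ?posrE ?exprn_gt0//.
  by rewrite ler_pXn2r// nnegrE ltW.
apply: ler_sum => i _; apply: ler_wpM2r; first exact: sqr_ge0.
by rewrite lerD2r ler_wpM2l// lef_pV2 ?posrE.
Qed.

Lemma lyapunov_ge_block (R : realType) (n m : nat) (d : 'I_n -> nat) (beta : R)
    (T eta : 'I_n -> R) (xs : blocks R d) (ls : 'rV[R]_m)
    (x : blocks R d) (lam : 'rV[R]_m) i :
  (forall i, 0 <= T i) -> (forall i, 0 <= eta i) -> 0 < beta ->
  eta i * enorm (x i - xs i) ^+ 2 <= lyapunov beta T eta xs ls x lam.
Proof.
move=> T0 eta0 b0; rewrite /lyapunov (bigD1 i)//= addrCA.
apply: (@le_trans _ _ ((T i / beta + eta i) * enorm (x i - xs i) ^+ 2)).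
  by rewrite ler_wpM2r ?sqr_ge0// lerDr divr_ge0// ltW.
rewrite lerDl addr_ge0// ?divr_ge0 ?sqr_ge0//.
by apply: sumr_ge0 => j _; rewrite mulr_ge0 ?sqr_ge0// addr_ge0// divr_ge0// ltW.
Qed.

Lemma lyapunov_ge_multiplier (R : realType) (n m : nat) (d : 'I_n -> nat)
    (beta : R) (T eta : 'I_n -> R) (xs : blocks R d) (ls : 'rV[R]_m)
    (x : blocks R d) (lam : 'rV[R]_m) :
  (forall i, 0 <= T i) -> (forall i, 0 <= eta i) -> 0 < beta ->
  enorm (lam - ls) ^+ 2 / beta ^+ 2 <= lyapunov beta T eta xs ls x lam.
Proof.
move=> T0 eta0 b0; rewrite /lyapunov lerDl.
by apply: sumr_ge0 => j _; rewrite mulr_ge0 ?sqr_ge0// addr_ge0// divr_ge0// ltW.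
Qed.

Lemma constraint_mapB (R : realType) (n m : nat) (d : 'I_n -> nat)
    (A : forall i, {linear 'rV[R]_(d i) -> 'rV[R]_m}) (x y : blocks R d) :
  constraint_map A x - constraint_map A y = \sum_i A i (x i - y i).
Proof. by rewrite -sumrB; apply: eq_bigr => i _; rewrite linearB. Qed.

(** Monotonicity gives one inequality per block. With [u] and [r] the new and
    the old residual, the multiplier update turns their sum into the decrease
    of the Lyapunov function, except for the terms
    [|u|^2 - 2 <u, r> = |u - r|^2 - |r|^2]. Since [u - r = sum_i A_i (x'_i - x_i)],
    the square [|u - r|^2] is absorbed by the [eta_i |x'_i - x_i|^2], and
    [- |r|^2] is gained. The error [L_i / 2 * |x'_i - x_i|^2] of the
    epsilon-subgradients is absorbed by [T_i]. *)
Lemma lyapunov_descent (R : realType) (n m : nat) (d : 'I_n -> nat)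
    (f : forall i, 'rV[R]_(d i) -> \bar R)
    (A : forall i, {linear 'rV[R]_(d i) -> 'rV[R]_m}) (b : 'rV[R]_m)
    (L T eta : 'I_n -> R) (beta : R) (xs : blocks R d) (ls : 'rV[R]_m)
    (x x' : blocks R d) (lam : 'rV[R]_m) :
  (forall i, Defs.proper (f i)) -> KKT_point f A b xs ls ->
  (forall i, L i <= T i) -> 0 < beta ->
  (forall i, eps_subdifferential (f i) (L i / 2 * enorm (x' i - x i) ^+ 2) (x' i)
     (- ((T i + beta * eta i) *: (x' i - x i)
         + adjoint (A i) (lambda_hat A b beta x lam)))) ->
  lyapunov beta T eta xs ls x' (lam + beta *: (constraint_map A x' - b))
    + (enorm (constraint_map A x - b) ^+ 2
       + \sum_i (eta i - n%:R * opnorm (A i) ^+ 2) * enorm (x' i - x i) ^+ 2)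
  <= lyapunov beta T eta xs ls x lam.
Proof.
move=> pf [feas dual] LT b0 step.
set r := constraint_map A x - b; set u := constraint_map A x' - b.
set P := lam - ls.
have blk i : dot (A i (x' i - xs i)) (P + beta *: r)
    + beta / 2 * ((T i / beta + eta i)
                  * (enorm (x' i - xs i) ^+ 2 - enorm (x i - xs i) ^+ 2)
                  + eta i * enorm (x' i - x i) ^+ 2) <= 0.
  have := dual i; rewrite subdifferential_eps0.
  move=> /(eps_subdifferential_monotone (pf i) (step i)).
  rewrite /lambda_hat -/r dotDl !dotNl dotDl dotZl opprK.
  rewrite ![dot (adjoint _ _) _]dotC -!dot_adjoint.
  have -> : x i - xs i = (x' i - xs i) - (x' i - x i).
    by rewrite opprB [RHS]addrC addrA subrK.
  have := ler_wpM2r (sqr_ge0 (enorm (x' i - x i))) (LT i).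
  move: (x' i - x i) (x' i - xs i) => D E.
  rewrite /P !sqr_enorm !(dotDl, dotDr, dotNl, dotNr) (dotC E D).
  have : T i = beta * (T i / beta) by rewrite mulrC divfK ?gt_eqF.
  move: (T i / beta) => t ->.
  lra.
have ub : enorm (u - r) ^+ 2 <=
    \sum_i n%:R * opnorm (A i) ^+ 2 * enorm (x' i - x i) ^+ 2.
  have -> : u - r = \sum_i A i (x' i - x i).
    by rewrite -constraint_mapB /u /r opprB addrA subrK.
  apply: le_trans (sqr_enorm_sum_le _) _; rewrite mulr_sumr.
  apply: ler_sum => i _; rewrite -mulrA ler_wpM2l// -exprMn.
  by rewrite ler_pXn2r ?nnegrE ?enorm_ge0 ?opnorm_le// (le_trans (enorm_ge0 _) (opnorm_le _ _)).
have uE : u = \sum_i A i (x' i - xs i) by rewrite -constraint_mapB feas.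
have : \sum_i (dot (A i (x' i - xs i)) (P + beta *: r)
    + beta / 2 * ((T i / beta + eta i)
                  * (enorm (x' i - xs i) ^+ 2 - enorm (x i - xs i) ^+ 2)
                  + eta i * enorm (x' i - x i) ^+ 2)) <= 0.
  by apply: sumr_le0 => i _.
rewrite big_split/= -mulr_sumr big_split/=.
under eq_bigr do rewrite dotC.
rewrite -dot_sumr -uE.
under [X in _ + _ * (X + _)]eq_bigr do rewrite mulrBr.
rewrite sumrB /lyapunov.
under [X in _ + (_ + X)]eq_bigr do rewrite mulrBl.
rewrite sumrB.
have -> : lam + beta *: u - ls = P + beta *: u by rewrite addrAC.
move: ub; rewrite -/P.
set S3 := \sum_i n%:R * _ * _; set S2 := \sum_i eta i * _.
set S1' := \sum_i _ * enorm (x' i - xs i) ^+ 2.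
set S1 := \sum_i _ * enorm (x i - xs i) ^+ 2.
clearbody S3 S2 S1 S1' u r P.
rewrite !sqr_enorm !dotE.
rewrite (dotC r u) (dotC u P) => ub main.
have {}main : 2 / beta * (dot P u + beta * dot u r + beta / 2 * (S1' - S1 + S2)) <= 0.
  by rewrite pmulr_rle0 ?divr_gt0// ?(dotC u r).
have -> : (dot P P + beta * dot P u + (beta * dot P u + beta * (beta * dot u u)))
   / beta ^+ 2 = dot P P / beta ^+ 2 + 2 / beta * dot P u + dot u u.
  by field; rewrite gt_eqF.
move: main.
have -> : 2 / beta * (dot P u + beta * dot u r + beta / 2 * (S1' - S1 + S2))
   = 2 / beta * dot P u + 2 * dot u r + (S1' - S1 + S2).
  by field; rewrite gt_eqF.
lra.
Qed.

(** * Convergence of vectors and closedness of the subdifferential *)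

Lemma cvg_sumr (R : realType) (T : Type) (F : set_system T) {FF : Filter F} (I : finType)
    (u : I -> T -> R) (l : I -> R) :
  (forall i, u i k @[k --> F] --> l i) ->
  \sum_i u i k @[k --> F] --> \sum_i l i.
Proof.
by move=> ul; apply: cvg_big => [|i _]; [exact: add_continuous|exact: ul].
Qed.

Lemma cvg_of_sqr_enorm (R : realType) (T : Type) (F : set_system T) {FF : Filter F} d
    (u : T -> 'rV[R]_d) (l : 'rV[R]_d) :
  enorm (u k - l) ^+ 2 @[k --> F] --> 0 -> u k @[k --> F] --> l.
Proof.
move=> ul; apply/cvgrPdist_lt => e e0.
near=> k; rewrite distrC; apply: le_lt_trans (norm_le_enorm _) _.
rewrite -(@ltr_pXn2r _ 2)// ?nnegrE ?enorm_ge0 ?ltW//.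
rewrite -[ltLHS]ger0_norm ?sqr_ge0//.
by near: k; apply: cvgr0_norm_lt => //; rewrite exprn_gt0.
Unshelve. all: by end_near. Qed.

Lemma cvg_coord (R : realType) (T : Type) (F : set_system T) {FF : Filter F} d
    (u : T -> 'rV[R]_d) (l : 'rV[R]_d) j :
  u k @[k --> F] --> l -> u k 0 j @[k --> F] --> l 0 j.
Proof.
move=> ul.
exact: (cvg_comp u (fun v : 'rV[R]_d => v 0 j) ul (@coord_continuous _ _ _ 0 j l)).
Qed.

Lemma cvg_dot (R : realType) (T : Type) (F : set_system T) {FF : Filter F} d
    (u v : T -> 'rV[R]_d) (l l' : 'rV[R]_d) :
  u k @[k --> F] --> l -> v k @[k --> F] --> l' ->
  dot (u k) (v k) @[k --> F] --> dot l l'.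
Proof.
by move=> ul vl; apply: cvg_sumr => j; apply: cvgM; exact: cvg_coord.
Qed.

Lemma cvg_sqr_enorm (R : realType) (T : Type) (F : set_system T) {FF : Filter F} d
    (u : T -> 'rV[R]_d) (l : 'rV[R]_d) :
  u k @[k --> F] --> l -> enorm (u k) ^+ 2 @[k --> F] --> enorm l ^+ 2.
Proof.
move=> ul; rewrite sqr_enorm; under eq_fun do rewrite sqr_enorm.
exact: cvg_dot.
Qed.

Lemma cvg_sqr_enorm_le (R : realType) (T : Type) (F : set_system T) {FF : Filter F} d
    (u : T -> 'rV[R]_d) (l : 'rV[R]_d) (V : T -> R) (c : R) :
  (forall k, enorm (u k - l) ^+ 2 <= c * V k) -> V k @[k --> F] --> 0 ->
  u k @[k --> F] --> l.
Proof.
move=> uV V0; apply: cvg_of_sqr_enorm.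
have cV : c * V k @[k --> F] --> 0.
  by rewrite -(mulr0 c); apply: cvgM => //; exact: cvg_cst.
apply: (squeeze_cvgr _ _ cV); last exact: cvg_cst.
by apply: nearW => k; rewrite sqr_ge0/=.
Qed.

Lemma cvg_sqr_enorm_dist (R : realType) (T : Type) (F : set_system T) {FF : Filter F} d
    (u : T -> 'rV[R]_d) (l : 'rV[R]_d) :
  u k @[k --> F] --> l -> enorm (u k - l) ^+ 2 @[k --> F] --> 0.
Proof.
move=> ul; have -> : 0 = enorm (l - l) ^+ 2.
  by rewrite subrr sqr_enorm dot0l.
by apply: cvg_sqr_enorm; apply: cvgB => //; exact: cvg_cst.
Qed.

(** The entries of [u k *m M] are dot products of [u k] with the columns of [M]. *)
Lemma cvg_mulmxr (R : realType) (T : Type) (F : set_system T) {FF : Filter F} d d'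
    (M : 'M[R]_(d, d')) (u : T -> 'rV[R]_d) (l : 'rV[R]_d) :
  u k @[k --> F] --> l -> u k *m M @[k --> F] --> l *m M.
Proof.
move=> ul; apply: cvg_of_sqr_enorm.
have -> : 0 = \sum_(j < d') (dot 0 (row j M^T) * dot 0 (row j M^T)) :> R.
  by rewrite big1// => j _; rewrite dot0l mul0r.
have E k : enorm (u k *m M - l *m M) ^+ 2 =
    \sum_(j < d') (dot (u k - l) (row j M^T) * dot (u k - l) (row j M^T)).
  rewrite -mulmxBl sqr_enorm; apply: eq_bigr => j _.
  by rewrite !mxE; congr (_ * _); apply: eq_bigr => i _; rewrite !mxE.
under eq_fun do rewrite E.
apply: cvg_sumr => j.
have ul0 : (u k - l) @[k --> F] --> (0 : 'rV[R]_d).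
  by rewrite -(subrr l); apply: cvgB => //; exact: cvg_cst.
by apply: cvgM; apply: cvg_dot => //; exact: cvg_cst.
Qed.

Lemma cvg_linear (R : realType) (T : Type) (F : set_system T) {FF : Filter F} d d'
    (A : {linear 'rV[R]_d -> 'rV[R]_d'}) (u : T -> 'rV[R]_d) l :
  u k @[k --> F] --> l -> A (u k) @[k --> F] --> A l.
Proof.
move=> ul; rewrite -mul_rV_lin1; under eq_fun do rewrite -mul_rV_lin1.
exact: cvg_mulmxr.
Qed.

(** By compactness the image filter has a cluster point, and for an ultrafilter
    a cluster point is a limit. *)
Lemma ultra_cvg_bounded (R : realType) (T : Type) (F : set_system T) d
    (u : T -> 'rV[R]_d) (l : 'rV[R]_d) (M : R) : UltraFilter F ->
  (forall k, enorm (u k - l) ^+ 2 <= M) -> exists p : 'rV[R]_d, u k @[k --> F] --> p.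
Proof.
move=> UF uM.
(* the radius [1 + M] because [a ^+ 2 <= M] implies [a <= 1 + M] *)
have cK : compact [set v : 'rV[R]_d |
    forall i, v ord0 i \in `[l 0 i - (1 + M), l 0 i + (1 + M)]%R].
  apply: (@rV_compact _ _ (fun i => `[l 0 i - (1 + M), l 0 i + (1 + M)]%classic)).
  by move=> i; exact: segment_compact.
have [|p [_ clp]] := cK (u @ F) (fmap_proper_filter u _).
  apply: (@filterE _ F) => k i; rewrite in_itv/= -ler_distl.
  have := le_trans (coord_sqr_le (u k - l) i) (uM k).
  rewrite !mxE -(real_normK (num_real (_ - _))).
  move: `|_| (normr_ge0 (u k 0 i - l 0 i)) => a a0 aM.
  by have := sqr_ge0 (a - 1); nra.
exists p => N Np.
have [//|FN] := in_ultra_setVsetC (u @^-1` N) UF.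
by have [q []] := clp (~` N) N FN Np.
Qed.

(** The inequalities say that the points [(x k, a k)], with [a k] an affine
    expression in [s k], lie in the epigraph of [f], so their limit does. *)
Lemma eps_subdifferential_limit (R : realType) (T : Type) (F : set_system T) d
    (f : 'rV[R]_d -> \bar R) (eps : T -> R) (x s : T -> 'rV[R]_d) xl sl :
  ProperFilter F -> closed (epigraph f) -> Defs.proper f ->
  (forall k, eps_subdifferential f (eps k) (x k) (s k)) ->
  eps k @[k --> F] --> 0 -> x k @[k --> F] --> xl -> s k @[k --> F] --> sl ->
  subdifferential f xl sl.
Proof.
move=> FF clf [fNy _] fs e0 xxl ssl z.
have := fNy z; case fz : (f z) => [r| |]// _; last by rewrite leey.
pose a k := r - dot (s k) (z - x k) + eps k.
have fxa k : epigraph f (x k, a k).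
  have := fs k z; rewrite fz /epigraph/= /a.
  have := fNy (x k); case: (f (x k)) => // y _.
  by rewrite -EFinD !lee_fin; lra.
have al : a k @[k --> F] --> r - dot sl (z - xl) + 0.
  apply: cvgD => //; apply: cvgB; first exact: cvg_cst.
  by apply: cvg_dot => //; apply: cvgB => //; exact: cvg_cst.
have /= : epigraph f (xl, r - dot sl (z - xl) + 0).
  apply: (@closed_cvg _ ('rV[R]_d * R^o)%type F FF (fun k => (x k, a k)) _ clf).
    exact: nearW.
  exact: (cvg_pair xxl al).
rewrite /epigraph/= addr0; have := fNy xl; case: (f xl) => // y _.
by rewrite -EFinD !lee_fin; lra.
Qed.

(** [D k] is squeezed between [0] and the decrement [V k - V k.+1] of a
    convergent sequence. *)
Lemma cvg_telescoping_decrease (R : realType) (V D : nat -> R) :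
  (forall k, 0 <= V k) -> (forall k, 0 <= D k) ->
  (forall k, V k.+1 + D k <= V k) -> D k @[k --> \oo] --> 0.
Proof.
move=> V0 D0 VD.
have cV : cvgn V.
  apply: nonincreasing_is_cvgn; last by exists 0 => _ [k _ <-].
  apply/nonincreasing_seqP => k; have := VD k; have := D0 k; lra.
have cV' : V k.+1 @[k --> \oo] --> limn V by rewrite (cvg_shiftS V).
have cD : V k - V k.+1 @[k --> \oo] --> 0.
  by rewrite -(subrr (limn V)); exact: cvgB cV cV'.
apply: (squeeze_cvgr _ _ cD); last exact: cvg_cst.
by apply: nearW => k; rewrite D0/=; have := VD k; lra.
Qed.

(** * Convergence of the iterates *)

(** One index where [V] is small suffices for a nonincreasing sequence, and
    convergence along any proper filter supplies it. *)
Lemma nonincreasing_cvg0 (R : realType) (F : set_system nat) (V : nat -> R) :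
  ProperFilter F -> (forall k, 0 <= V k) -> (forall k, V k.+1 <= V k) ->
  V k @[k --> F] --> 0 -> V k @[k --> \oo] --> 0.
Proof.
move=> FF V0 VS /cvgr0_norm_lt VF; apply/cvgr0Pnorm_lt => e e0.
have [k0] := @filter_ex _ F FF _ (VF _ e0).
rewrite ger0_norm// => Ve.
exists k0 => // k /= kk; rewrite ger0_norm//; apply: le_lt_trans Ve.
exact: (proj1 (nonincreasing_seqP V)).
Qed.

Lemma lyapunov_cvg0 (R : realType) (U : Type) (F : set_system U) {FF : Filter F} (n m : nat)
    (d : 'I_n -> nat) (beta : R) (T eta : 'I_n -> R) (xs : blocks R d)
    (ls : 'rV[R]_m) (x : U -> blocks R d) (lam : U -> 'rV[R]_m) :
  (forall i, x k i @[k --> F] --> xs i) -> lam k @[k --> F] --> ls ->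
  lyapunov beta T eta xs ls (x k) (lam k) @[k --> F] --> 0.
Proof.
move=> cx clam.
have -> : 0 = 0 / beta ^+ 2 + \sum_i (T i / beta + eta i) * 0.
  by rewrite mul0r add0r big1// => i _; rewrite mulr0.
apply: cvgD; first by apply: cvgM; [exact: cvg_sqr_enorm_dist|exact: cvg_cst].
by apply: cvg_sumr => i; apply: cvgM; [exact: cvg_cst|exact: cvg_sqr_enorm_dist].
Qed.

(** The convergence argument for abstract summands: all that it uses about the
    primal update is that it produces the epsilon-subgradients of
    [prox_gradient_step]. *)
Lemma linearized_ADMM_cvg (R : realType) (n m : nat) (d : 'I_n -> nat)
    (f : forall i, 'rV[R]_(d i) -> \bar R) (L : 'I_n -> R)
    (A : forall i, {linear 'rV[R]_(d i) -> 'rV[R]_m}) (b : 'rV[R]_m)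
    (beta : nat -> R) (T eta : 'I_n -> R)
    (x : nat -> blocks R d) (lam : nat -> 'rV[R]_m) :
  (forall i, closed_proper_convex (f i)) ->
  (exists (xs : blocks R d) (ls : 'rV[R]_m), KKT_point f A b xs ls) ->
  (forall k, 0 < beta k) -> (forall k, beta k <= beta k.+1) ->
  (exists M : R, forall k, beta k <= M) ->
  (forall i, 0 < T i) -> (forall i, L i <= T i) ->
  (forall i, 0 < eta i) -> (forall i, n%:R * opnorm (A i) ^+ 2 < eta i) ->
  (forall k i, eps_subdifferential (f i)
     (L i / 2 * enorm (x k.+1 i - x k i) ^+ 2) (x k.+1 i)
     (- ((T i + beta k * eta i) *: (x k.+1 i - x k i)
         + adjoint (A i) (lambda_hat A b (beta k) (x k) (lam k))))) ->
  (forall k, lam k.+1 = lam k + beta k *: (constraint_map A (x k.+1) - b)) ->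
  exists (xs : blocks R d) (ls : 'rV[R]_m),
    [/\ KKT_point f A b xs ls,
        forall i, x k i @[k --> \oo] --> xs i
      & lam k @[k --> \oo] --> ls].
Proof.
move=> cpc [xs0 [ls0 kkt0]] beta0 betaS [M betaM] T0 LT eta0 eta_gt step lamS.
have pf i : Defs.proper (f i) by case: (cpc i).
have T0' i := ltW (T0 i); have eta0' i := ltW (eta0 i).
have M0 : 0 < M by exact: lt_le_trans (betaM 0%N).
pose V xs ls k := lyapunov (beta k) T eta xs ls (x k) (lam k).
pose gap i := eta i - n%:R * opnorm (A i) ^+ 2.
pose D k := enorm (constraint_map A (x k) - b) ^+ 2
  + \sum_i gap i * enorm (x k.+1 i - x k i) ^+ 2.
have gap0 i : 0 < gap i by rewrite subr_gt0.
have gapD0 k i : 0 <= gap i * enorm (x k.+1 i - x k i) ^+ 2.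
  by rewrite mulr_ge0 ?sqr_ge0// ltW.
have D0 k : 0 <= D k by rewrite addr_ge0 ?sqr_ge0// sumr_ge0.
have lamV xs ls k : enorm (lam k - ls) ^+ 2 <= M ^+ 2 * V xs ls k.
  apply: (@le_trans _ _ (beta k ^+ 2 * V xs ls k)).
    rewrite mulrC -ler_pdivrMr ?exprn_gt0//; exact: lyapunov_ge_multiplier.
  rewrite ler_wpM2r//; last by rewrite ler_pXn2r// nnegrE ltW.
  apply: le_trans (lyapunov_ge_multiplier _ _ _ _ _ _ _) => //.
  by rewrite divr_ge0 ?sqr_ge0.
have xV xs ls k i : enorm (x k i - xs i) ^+ 2 <= (eta i)^-1 * V xs ls k.
  by rewrite mulrC ler_pdivlMr// mulrC; exact: lyapunov_ge_block.
have V0 xs ls k : 0 <= V xs ls k.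
  by rewrite -(@pmulr_rge0 _ (M ^+ 2)) ?exprn_gt0// (le_trans (sqr_ge0 _) (lamV _ _ _)).
have VD xs ls k : KKT_point f A b xs ls -> V xs ls k.+1 + D k <= V xs ls k.
  move=> kkt; apply: le_trans (lyapunov_descent pf kkt LT (beta0 k) (step k)).
  by rewrite -lamS lerD2r; exact: lyapunov_antitone.
have VS xs ls k : KKT_point f A b xs ls -> V xs ls k.+1 <= V xs ls k.
  by move=> kkt; apply: le_trans (VD _ _ k kkt); rewrite lerDl.
have VV0 xs ls k : KKT_point f A b xs ls -> V xs ls k <= V xs ls 0%N.
  by move=> kkt; apply: (proj1 (nonincreasing_seqP (V xs ls))) => // j; exact: VS.
have cD : D k @[k --> \oo] --> 0.
  exact: cvg_telescoping_decrease (V0 xs0 ls0) D0 (fun k => VD _ _ k kkt0).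
have cr : constraint_map A (x k) @[k --> \oo] --> b.
  apply: (@cvg_sqr_enorm_le _ _ _ _ _ _ _ _ 1 _ cD) => k.
  by rewrite mul1r lerDl sumr_ge0.
have cdx i : x k.+1 i - x k i @[k --> \oo] --> (0 : 'rV[R]_(d i)).
  apply: (@cvg_sqr_enorm_le _ _ _ _ _ _ _ _ (gap i)^-1 _ cD) => k.
  rewrite subr0 mulrC ler_pdivlMr// mulrC /D (bigD1 i)//= addrCA lerDl.
  by rewrite addr_ge0 ?sqr_ge0// sumr_ge0.
have cbeta : beta k @[k --> \oo] --> limn beta.
  apply: nondecreasing_is_cvgn; first exact/nondecreasing_seqP.
  by exists M => _ [k _ <-].
(* a single ultrafilter serves all blocks and the multiplier, with no nested
   extraction of subsequences *)
have [F [UF ooF]] := ultraFilterLemma (eventually_filter).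
have along_F (U : Type) (u : nat -> U) (G : set_system U) :
    u k @[k --> \oo] `=>` G -> u k @[k --> F] `=>` G.
  by move=> ul N /ul; exact: ooF.
have [xs cxs] : exists xs : blocks R d, forall i, x k i @[k --> F] --> xs i.
  have ex i : exists p : 'rV[R]_(d i), x k i @[k --> F] --> p.
    apply: (@ultra_cvg_bounded _ _ _ _ _ (xs0 i) ((eta i)^-1 * V xs0 ls0 0%N)) => k.
    by apply: le_trans (xV _ ls0 _ _) _; rewrite ler_wpM2l ?invr_ge0// VV0.
  by exists (fun i => projT1 (cid (ex i))) => i; exact: (projT2 (cid (ex i))).
have [ls cls] : exists ls : 'rV[R]_m, lam k @[k --> F] --> ls.
  apply: (@ultra_cvg_bounded _ _ _ _ _ ls0 (M ^+ 2 * V xs0 ls0 0%N)) => k.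
  by apply: le_trans (lamV xs0 _ _) _; rewrite ler_wpM2l ?sqr_ge0// VV0.
have FF : ProperFilter F by case: UF.
have clhat : lambda_hat A b (beta k) (x k) (lam k) @[k --> F] --> ls.
  rewrite -[ls]addr0 -(scaler0 _ (limn beta)) -(subrr b).
  apply: cvgD => //; apply: cvgZ; first exact: along_F.
  by apply: cvgB; [exact: along_F|exact: cvg_cst].
have cdxF i : x k.+1 i - x k i @[k --> F] --> (0 : 'rV[R]_(d i)) by exact: along_F.
have kkt : KKT_point f A b xs ls.
  split.
    have cA : constraint_map A (x k) @[k --> F] --> constraint_map A xs.
      apply: cvg_big => [|i _]; [exact: add_continuous|exact: cvg_linear].
    exact: (cvg_unique _ cA (along_F _ _ _ cr)).
  move=> i; case: (cpc i) => clf _ _.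
  apply: (eps_subdifferential_limit FF clf (pf i) (step^~ i)).
  - rewrite -(mulr0 (L i / 2)); apply: cvgM; first exact: cvg_cst.
    suff : enorm (x k.+1 i - x k i) ^+ 2 @[k --> F]
        --> enorm (0 : 'rV[R]_(d i)) ^+ 2 by rewrite [enorm 0 ^+ 2]sqr_enorm dot0l.
    by apply: cvg_sqr_enorm; exact: cdxF.
  - have : x k i + (x k.+1 i - x k i) @[k --> F] --> xs i + 0.
      by apply: cvgD; [exact: cxs|exact: cdxF].
    by rewrite addr0; under eq_fun do rewrite addrC subrK.
  - apply: cvgN; rewrite -[adjoint _ _]add0r -(scaler0 _ (T i + limn beta * eta i)).
    apply: cvgD; last exact: cvg_mulmxr.
    apply: cvgZ; last exact: cdxF.
    apply: cvgD; first exact: cvg_cst.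
    by apply: cvgM; [exact: along_F|exact: cvg_cst].
have cV : V xs ls k @[k --> \oo] --> 0.
  apply: (nonincreasing_cvg0 FF) => // [k|]; first exact: VS.
  (* the weights for [beta 0] are the largest ones and do not depend on [k] *)
  have c0 : lyapunov (beta 0%N) T eta xs ls (x k) (lam k) @[k --> F] --> 0.
    exact: lyapunov_cvg0.
  apply: (squeeze_cvgr _ _ c0); last exact: cvg_cst.
  apply: nearW => k; rewrite V0/=; apply: lyapunov_antitone => //.
  exact: (proj1 (nondecreasing_seqP beta)).
exists xs, ls; split=> // [i|].
  exact: (cvg_sqr_enorm_le (fun k => xV xs ls k i) cV).
exact: (cvg_sqr_enorm_le (lamV xs ls) cV).
Qed.

Theorem theorem6 (R : realType) (n m : nat) (d : 'I_n -> nat)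
    (g : forall i, 'rV[R]_(d i) -> R) (h : forall i, 'rV[R]_(d i) -> \bar R)
    (L : 'I_n -> R)
    (A : forall i, {linear 'rV[R]_(d i) -> 'rV[R]_m}) (b : 'rV[R]_m)
    (g_convex : forall i, @convex_function R 'rV[R]_(d i) setT (g i))
    (h_convex : forall i, econvex (h i))
    (g_diff : forall i x, differentiable (g i) x)
    (grad_lipschitz : forall i x y,
       enorm (grad (g i) x - grad (g i) y) <= L i * enorm (x - y))
    (f_cpc : forall i, closed_proper_convex (composite g h i))
    (A_neq0 : forall i, exists x, A i x != 0)
    (sol_nonunique : exists x y : blocks R d,
       [/\ constraint_map A x = b, constraint_map A y = b & x <> y])
    (A_onto : forall c : 'rV[R]_m, exists x : blocks R d,
       constraint_map A x = c)
    (KKT_exists : exists (x : blocks R d) (lam : 'rV[R]_m),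
       KKT_point (composite g h) A b x lam)
    (beta : nat -> R) (T eta : 'I_n -> R) (tau : nat -> 'I_n -> R)
    (beta_gt0 : forall k, 0 < beta k)
    (beta_nondecreasing : forall k, beta k <= beta k.+1)
    (beta_bounded : exists M : R, forall k, beta k <= M)
    (T_gt0 : forall i, 0 < T i) (T_ge : forall i, L i <= T i)
    (eta_gt0 : forall i, 0 < eta i)
    (eta_gt : forall i, n%:R * opnorm (A i) ^+ 2 < eta i)
    (tauE : forall k i, tau k i = T i + beta k * eta i)
    (x : nat -> blocks R d) (lam : nat -> 'rV[R]_m)
    (x_lam_generated : proximal_LADMPSAP g h A b beta tau x lam) :
  exists (xs : blocks R d) (lams : 'rV[R]_m),
    [/\ KKT_point (composite g h) A b xs lams,
        forall i, x k i @[k --> \oo] --> xs i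
      & lam k @[k --> \oo] --> lams].
Proof.
apply: (linearized_ADMM_cvg (L := L) (T := T) (eta := eta) f_cpc KKT_exists beta_gt0
  beta_nondecreasing beta_bounded) => // [k i|k]; last by case: (x_lam_generated k).
case: (x_lam_generated k) => /(_ i) xmin _; rewrite -tauE.
have [_ pf _] := f_cpc i.
apply: prox_gradient_step (proper_summand pf) _ xmin => //.
by rewrite tauE addr_gt0// mulr_gt0.
Qed.
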